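(* Let $\mathcal{C}=\langle E,c,\{\mathcal{R}_i\}_{i=1}^n\rangle$ be a covering problem, $\Omega\subseteq 2^{[n]}$ an uncertainty set and $\lambda\ge1$ an inflation parameter. Suppose there are: an $\alpha_{off}$-approximation algorithm for the augmentation problem of $\mathcal{C}$; a polynomial-time deterministic $\alpha_{on}$-competitive online algorithm for $\mathcal{C}$; and an $\alpha_{mm}$-approximation algorithm for the max-min augmentation problem, i.e. an algorithm that given any $S\subseteq E$ outputs $X\in\Omega$ with $\mathrm{Opt}_{aug}(X\mid S)\ge\frac{1}{\alpha_{mm}}\max_{Y\in\Omega}\mathrm{Opt}_{aug}(Y\mid S)$. Then there is an $O(\alpha_{off}\cdot\alpha_{on}\cdot\alpha_{mm})$-approximation algorithm for the robust covering problem $\langle E,c,\{\mathcal{R}_i\}_{i=1}^n,\Omega,\lambda\rangle$.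
   Context: A covering problem $\mathcal{C}=\langle E,c,\{\mathcal{R}_i\}_{i=1}^n\rangle$ has a finite ground set $E$ with costs $c:E\to\mathbb{R}_{\ge0}$ ($c(F)=\sum_{e\in F}c_e$) and requirements $i\in[n]$, each given by an upward-closed family $\mathcal{R}_i\subseteq2^E$; $F$ satisfies $i$ iff $F\in\mathcal{R}_i$. For $S\subseteq E$, $X\subseteq[n]$: $\mathrm{Opt}_{aug}(X\mid S)=\min\{c(A):A\subseteq E,\ S\cup A\in\mathcal{R}_i\ \forall i\in X\}$, $\mathrm{Opt}(X)=\mathrm{Opt}_{aug}(X\mid\emptyset)$. An $\alpha_{off}$-approximation algorithm for the augmentation problem, given $S\subseteq E$, $X\subseteq[n]$, outputs $A$ with $S\cup A\in\mathcal{R}_i$ for all $i\in X$ and $c(A)\le\alpha_{off}\mathrm{Opt}_{aug}(X\mid S)$. In the online version, requirements arrive one by one in a sequence $\sigma$; a deterministic online algorithm $\mathcal{A}_{on}$ maintains $\mathcal{A}_{on}(\sigma)\subseteq E$ satisfying all arrived requirements, only adding elements over time; it is $\alpha_{on}$-competitive if $c(\mathcal{A}_{on}(\sigma))\le\alpha_{on}\mathrm{Opt}(\text{requirements in }\sigma)$ for all $\sigma$. The robust covering problem $\langle E,c,\{\mathcal{R}_i\},\Omega,\lambda\rangle$: a feasible solution is a first-stage set $E_0\subseteq E$ together with an augmentation procedure that, for each scenario $\omega\in\Omega$, outputs $E_\omega\subseteq E$ such that $E_0\cup E_\omega\in\mathcal{R}_i$ for all $i\in\omega$; its objective is $c(E_0)+\lambda\max_{\omega\in\Omega}c(E_\omega)$,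 to be minimized. A $\rho$-approximation algorithm outputs a feasible solution with objective at most $\rho$ times the optimum. *)

(* Defs.v *)
From HB Require Import structures.
From mathcomp Require Import all_boot all_order all_algebra.
From mathcomp Require Import reals.
Set Implicit Arguments.
Unset Strict Implicit.
Unset Printing Implicit Defensive.
Import Order.TTheory GRing.Theory Num.Theory.
Local Open Scope ring_scope.

(** * Model of computation

    Costs are arbitrary real numbers, so "polynomial time" is taken in the
    real-number (Blum-Shub-Smale / real RAM) model: exact field operations and
    comparisons on reals have unit cost.  The machine is a small first-order
    language over binary trees with real leaves.  Programs are finite syntax
    and do not depend on the instance; the only built-in real constants are 0
    and 1, so that no information can be hidden in a constant. *)

Inductive data (R : Type) : Type :=
| Nil
| Real of R
| Pair of data R & data R.

Arguments Nil {R}.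

Fixpoint dsize (R : Type) (x : data R) : nat :=
  if x is Pair y z then (dsize y + dsize z).+1 else 1%N.

Inductive prim : Type :=
  Id | Fst | Snd | MkNil | Zero | One | Add | Sub | Mul | Div | Leq.

Inductive prog : Type :=
| Prim of prim
| Comp of prog & prog           (* [Comp q p] runs [p], then [q] on its result *)
| Fork of prog & prog
| If of prog & prog & prog
| While of prog & prog.

Section Encodings.
Variable R : Type.

Definition truthy (x : data R) : bool := if x is Nil then false else true.

Definition enc_bool (b : bool) : data R := if b then Pair Nil Nil else Nil.
Definition enc_seq (s : seq (data R)) : data R := foldr (@Pair R) Nil s.
(* unary; only used for the number of requirements and their indices *)
Definition enc_nat (n : nat) : data R := enc_seq (nseq n Nil).
(* characteristic vector *)
Definition enc_set (T : finType) (A : {set T}) : data R :=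
  enc_seq [seq enc_bool (x \in A) | x <- enum T].
Definition enc_ords (n : nat) (s : seq 'I_n) : data R :=
  enc_seq [seq enc_nat i | i : 'I_n <- s].
End Encodings.

Arguments enc_bool {R}.
Arguments enc_nat {R}.
Arguments enc_set {R T}.
Arguments enc_ords {R n}.

(* Ill-typed operations return [Nil]. *)
Definition prim_eval (R : realType) (o : prim) (x : data R) : data R :=
  match o, x with
  | Id, _ => x
  | Fst, Pair y _ => y
  | Snd, Pair _ z => z
  | MkNil, _ => Nil
  | Zero, _ => Real 0
  | One, _ => Real 1
  | Add, Pair (Real a) (Real b) => Real (a + b)
  | Sub, Pair (Real a) (Real b) => Real (a - b)
  | Mul, Pair (Real a) (Real b) => Real (a * b)
  | Div, Pair (Real a) (Real b) => Real (a / b)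
  | Leq, Pair (Real a) (Real b) => enc_bool (a <= b)
  | _, _ => Nil
  end.

(* [eval p x t y]: on input [x], program [p] halts after [t] steps with output
   [y].  Duplicating a value is one step, as for a pointer. *)
Inductive eval (R : realType) :
    prog -> data R -> nat -> data R -> Prop :=
| eval_prim o x : eval (Prim o) x 1 (prim_eval o x)
| eval_comp p q x y z t u :
    eval p x t y -> eval q y u z -> eval (Comp q p) x (t + u).+1 z
| eval_fork p q x y z t u :
    eval p x t y -> eval q x u z -> eval (Fork p q) x (t + u).+1 (Pair y z)
| eval_if b p q x v y t u :
    eval b x t v -> eval (if truthy v then p else q) x u y ->
    eval (If b p q) x (t + u).+1 y
| eval_while_stop b p x t :
    eval b x t Nil -> eval (While b p) x t.+1 x
| eval_while_step b p x v y z t u w :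
    eval b x t v -> truthy v -> eval p x u y -> eval (While b p) y w z ->
    eval (While b p) x (t + u + w).+1 z.

(* A polynomial time bound is given by one [k] used for all inputs: every
   polynomial in N >= 1 is at most k * N ^ k for some k, and dsize x >= 1. *)
Definition runs_within (R : realType) (k : nat) (p : prog) (x y : data R) :
    Prop :=
  exists t : nat, eval p x t y /\ (t <= k * dsize x ^ k)%N.

(** * Covering problems *)

Record covering_problem (R : realType) : Type := CoveringProblem {
  ground : finType;
  elt_cost : ground -> R;
  nreq : nat;
  req : 'I_nreq -> {set {set ground}};
  elt_cost_ge0 : forall e, 0 <= elt_cost e;
  req_upward : forall i (F G : {set ground}),
    F \subset G -> F \in req i -> G \in req i
}.

Section Covering.
Variables (R : realType) (C : covering_problem R).
Implicit Types (A F S : {set ground C}) (X : {set 'I_(nreq C)}).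
Implicit Types (Omega : {set {set 'I_(nreq C)}}) (lambda : R).

Definition cost F : R := \sum_(e in F) elt_cost e.

Definition satisfies F X : bool := [forall i in X, F \in req i].

(* As costs are nonnegative, the default value [cost setT] is at least the cost
   of every set, so this is the minimum as soon as some set is feasible. *)
Definition opt_aug X S : R :=
  \big[Num.min/cost setT]_(A : {set ground C} | satisfies (S :|: A) X) cost A.

Definition opt X : R := opt_aug X set0.

Definition maxmin_aug Omega S : R :=
  \big[Num.max/0]_(Y in Omega) opt_aug Y S.

Definition robust_feasible Omega E0
    (aug : {set 'I_(nreq C)} -> {set ground C}) : bool :=
  [forall w in Omega, satisfies (E0 :|: aug w) w].

Definition robust_cost Omega lambda E0
    (aug : {set 'I_(nreq C)} -> {set ground C}) : R :=
  cost E0 + lambda * \big[Num.max/0]_(w in Omega) cost (aug w).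

(* The default value is again an upper bound on every objective value (for
   [0 <= lambda]); values of [s.2] outside [Omega] are irrelevant. *)
Definition robust_opt Omega lambda : R :=
  \big[Num.min/cost setT + lambda * cost setT]_(
      s : {set ground C} * {ffun {set 'I_(nreq C)} -> {set ground C}}
      | robust_feasible Omega s.1 s.2)
    robust_cost Omega lambda s.1 s.2.

(* Ground set, costs and number of requirements are listed explicitly; the
   families [req] (possibly of exponential size) are presented implicitly by
   the problem-specific description [d], e.g. a graph. *)
Definition enc_covering (d : data R) : data R :=
  Pair (enc_seq [seq Real (elt_cost e) | e <- enum (ground C)])
       (Pair (enc_nat (nreq C)) d).

End Covering.

(** * Algorithms

    An algorithm solves a whole family of instances, indexed by [I]; [dC] and
    [dO] present the requirements and the uncertainty set to the algorithms.
    Ratios may depend on the instance. *)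

Section Algorithms.
Variables (R : realType) (I : Type) (C : I -> covering_problem R).
Variables (dC dO : I -> data R).
Variable Omega : forall i, {set {set 'I_(nreq (C i))}}.
Variable lambda : I -> R.

Definition augmentation_algorithm (alpha : I -> R) : Prop :=
  exists (p : prog) (k : nat)
    (A : forall i,
       {set ground (C i)} -> {set 'I_(nreq (C i))} -> {set ground (C i)}),
  forall i S X,
    [/\ runs_within k p
          (Pair (enc_covering (C i) (dC i)) (Pair (enc_set S) (enc_set X)))
          (enc_set (A i S X)),
        satisfies (S :|: A i S X) X
      & cost (A i S X) <= alpha i * opt_aug X S].

Definition online_algorithm (alpha : I -> R) : Prop :=
  exists (p : prog) (k : nat)
    (A : forall i, seq 'I_(nreq (C i)) -> {set ground (C i)}),
  forall i (sigma : seq 'I_(nreq (C i))),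
    [/\ runs_within k p
          (Pair (enc_covering (C i) (dC i)) (enc_ords sigma))
          (enc_set (A i sigma)),
        satisfies (A i sigma) [set r in sigma],
        forall r, A i sigma \subset A i (rcons sigma r)
      & cost (A i sigma) <= alpha i * opt [set r in sigma]].

Definition maxmin_algorithm (alpha : I -> R) : Prop :=
  exists (p : prog) (k : nat)
    (A : forall i, {set ground (C i)} -> {set 'I_(nreq (C i))}),
  forall i S,
    [/\ runs_within k p
          (Pair (enc_covering (C i) (dC i)) (Pair (dO i) (enc_set S)))
          (enc_set (A i S)),
        A i S \in Omega i
      & (alpha i)^-1 * maxmin_aug (Omega i) S <= opt_aug (A i S) S].

Definition enc_robust (i : I) : data R :=
  Pair (enc_covering (C i) (dC i)) (Pair (dO i) (Real (lambda i))).

(* [p1] computes the first-stage set; [p2] is the augmentation procedure. *)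
Definition robust_algorithm (rho : I -> R) : Prop :=
  exists (p1 p2 : prog) (k : nat) (E0 : forall i, {set ground (C i)})
    (aug : forall i, {set 'I_(nreq (C i))} -> {set ground (C i)}),
  forall i,
    [/\ runs_within k p1 (enc_robust i) (enc_set (E0 i)),
        forall w, w \in Omega i ->
          runs_within k p2 (Pair (enc_robust i) (enc_set w))
            (enc_set (aug i w)),
        robust_feasible (Omega i) (E0 i) (aug i)
      & robust_cost (Omega i) (lambda i) (E0 i) (aug i)
          <= rho i * robust_opt (Omega i) (lambda i)].

End Algorithms.

Arguments augmentation_algorithm {R I} C dC alpha.
Arguments online_algorithm {R I} C dC alpha.
Arguments maxmin_algorithm {R I} C dC dO Omega alpha.
Arguments robust_algorithm {R I} C dC dO Omega lambda rho.

(* Main.v *)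
(* Interleave the max-min and the online algorithm: F_t is the online solution
   for the scenarios found so far, and the next scenario is the max-min answer
   at F_t.  The textbook version stops as soon as the increment
   c(F_{t+1}) - c(F_t) is at most 2 * alpha_on * T, where T, the second-stage
   cost of an optimal solution, is guessed.  No guess is needed, which matters
   with real costs, where the range of T has no polynomial discretization: the
   F_t do not depend on T, and the F_t minimizing
   c(F_t) + lambda * (c(F_{t+1}) - c(F_t)) is at least as good.  As the F_t
   increase, one of the first |E| + 1 increments is 0, so |E| + 1 rounds
   suffice.

   The increment bounds the augmentation cost of the next scenario, hence, up
   to alpha_mm, that of every scenario.  If one of the ratios is less than 1,
   all the scenarios can be satisfied at cost 0.

   On the machine side, polynomial running times are composed without explicit
   polynomials: everything is bounded by a power of the size of the instance. *)

Require Import Defs.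
From HB Require Import structures.
From mathcomp Require Import all_boot all_order all_algebra.
From mathcomp Require Import boolp reals.
From mathcomp Require Import ring lra zify.
Set Implicit Arguments.
Unset Strict Implicit.
Unset Printing Implicit Defensive.
Import Order.TTheory GRing.Theory Num.Theory.
Local Open Scope ring_scope.

(** * Polynomial time *)

Section PolyBounded.
Local Open Scope nat_scope.
Variables (J : Type) (N : J -> nat).

(* The base is at least 2, so that constants are absorbed by the exponent. *)
Definition poly_bounded (f : J -> nat) : Prop :=
  exists k, forall j, f j <= (N j).+2 ^ k.

Lemma poly_bounded_le f g :
  (forall j, f j <= g j) -> poly_bounded g -> poly_bounded f.
Proof. by move=> lefg [k gk]; exists k => j; apply: leq_trans (gk j). Qed.

Lemma poly_bounded_const c : poly_bounded (fun=> c).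
Proof.
exists c => j; apply: leq_trans (ltnW (ltn_expl c (isT : 1 < 2))) _.
by case: c => // c; rewrite leq_exp2r.
Qed.

Lemma poly_bounded_size : poly_bounded N.
Proof. by exists 1 => j; rewrite expn1 -addn2 leq_addr. Qed.

Lemma poly_boundedM f g :
  poly_bounded f -> poly_bounded g -> poly_bounded (fun j => f j * g j).
Proof.
by move=> [k fk] [l gl]; exists (k + l) => j; rewrite expnD leq_mul.
Qed.

Lemma poly_boundedD f g :
  poly_bounded f -> poly_bounded g -> poly_bounded (fun j => f j + g j).
Proof.
move=> [k fk] [l gl]; exists (k + l).+1 => j.
rewrite expnS (leq_trans (leq_add (fk j) (gl j))) //.
apply: (@leq_trans (2 * (N j).+2 ^ (k + l))); last by rewrite leq_mul2r orbT.
by rewrite mul2n -addnn leq_add // leq_exp2l // (leq_addr, leq_addl).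
Qed.

Lemma poly_boundedX f k : poly_bounded f -> poly_bounded (fun j => f j ^ k).
Proof.
move=> pf; elim: k => [|k IH]; first exact: poly_bounded_const.
by under [fun j => _]funext => j do rewrite expnS; apply: poly_boundedM.
Qed.

End PolyBounded.

Lemma poly_bounded_reindex (J J' : Type) (N : J -> nat) (N' : J' -> nat)
    (h : J' -> J) (f : J -> nat) :
  (forall j, N (h j) <= N' j)%N ->
  poly_bounded N f -> poly_bounded N' (fun j => f (h j)).
Proof.
move=> le_N [k fk]; exists k => j; apply: leq_trans (fk _) _.
by case: k {fk} => // k; rewrite leq_exp2r // !ltnS.
Qed.

(** * Running times of programs: loop-free code, composition and binding *)

Section Programs.
Variable R : realType.
Implicit Types (p q : prog) (a : data R).

Fixpoint while_free p : bool :=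
  match p with
  | Prim _ => true
  | Comp q r | Fork q r => while_free q && while_free r
  | If b q r => [&& while_free b, while_free q & while_free r]
  | While _ _ => false
  end.

(* Junk value on loops. *)
Fixpoint sem p a : data R :=
  match p with
  | Prim o => prim_eval o a
  | Comp q r => sem q (sem r a)
  | Fork q r => Pair (sem q a) (sem r a)
  | If b q r => if truthy (sem b a) then sem q a else sem r a
  | While _ _ => a
  end.

Fixpoint prog_size p : nat :=
  match p with
  | Prim _ => 1
  | Comp q r | Fork q r | While q r => (prog_size q + prog_size r).+1
  | If b q r => (prog_size b + (prog_size q + prog_size r)).+1
  end.

(** A primitive takes one step and every other construct adds one, so without loops the syntax alone
    bounds the time. Correctness of such code reduces to computing [sem], mostly by conversion. *)
Lemma eval_while_free p a : while_free p ->
  exists2 t, (t <= prog_size p)%N & eval p a t (sem p a).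
Proof.
elim: p a => [o|q IHq r IHr|q IHq r IHr|b IHb q IHq r IHr|] //= a.
- by move=> _; exists 1%N => //; apply: eval_prim.
- case/andP=> /IHq {}IHq /IHr {}IHr.
  have [t t_le ev_t] := IHr a; have [u u_le ev_u] := IHq (sem r a).
  exists (t + u).+1; last exact: eval_comp ev_t ev_u.
  by rewrite ltnS addnC leq_add.
- case/andP=> /IHq {}IHq /IHr {}IHr.
  have [t t_le ev_t] := IHq a; have [u u_le ev_u] := IHr a.
  by exists (t + u).+1; [rewrite ltnS leq_add | exact: eval_fork].
- case/and3P=> /IHb {}IHb /IHq {}IHq /IHr {}IHr.
  have [t t_le ev_t] := IHb a.
  have [u u_le ev_u] : exists2 u, (u <= prog_size q + prog_size r)%N &
      eval (if truthy (sem b a) then q else r) a u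
        (if truthy (sem b a) then sem q a else sem r a).
    case: (truthy _).
      have [u u_le ev_u] := IHq a.
      by exists u => //; apply: leq_trans u_le (leq_addr _ _).
    have [u u_le ev_u] := IHr a.
    by exists u => //; apply: leq_trans u_le (leq_addl _ _).
  by exists (t + u).+1; [rewrite ltnS leq_add | exact: eval_if ev_t ev_u].
Qed.

Lemma dsize_gt0 a : (0 < dsize a)%N.
Proof. by case: a. Qed.

Lemma runs_within_leq k l p a b :
  (k <= l)%N -> runs_within k p a b -> runs_within l p a b.
Proof.
move=> le_kl [t [ev_t t_le]]; exists t; split=> //; apply: leq_trans t_le _.
by rewrite leq_mul // leq_pexp2l // dsize_gt0.
Qed.

(** Time is measured against an ambient size [N j] shared by all stages, not against [dsize (x j)].
    Composition then needs no bound on intermediate results; sizes matter only for folded lists and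
    for the inputs of the given algorithms, in [ptime_of_runs_within]. *)
Definition ptime (J : Type) (N : J -> nat) p (x y : J -> data R) : Prop :=
  exists2 f, poly_bounded N f &
    forall j, exists2 t, (t <= f j)%N & eval p (x j) t (y j).

Lemma ptime_runs_within (J : Type) p (x y : J -> data R) :
  ptime (fun j => dsize (x j)) p x y ->
  exists k, forall j, runs_within k p (x j) (y j).
Proof.
(* For [n = dsize (x j) >= 1], [(n + 2) ^ k <= (3 * n) ^ k <= 3 ^ k * n ^ (3 ^ k)], as
   [k < 3 ^ k]. *)
case=> f [k fk] evp; exists (3 ^ k)%N => j; have [t t_le ev_t] := evp j.
exists t; split=> //; apply: leq_trans t_le (leq_trans (fk j) _).
have s1 := dsize_gt0 (x j).
apply: (@leq_trans ((3 * dsize (x j)) ^ k)).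
  case: {fk}k => // k; rewrite leq_exp2r // mulSn -addn2 leq_add2l.
  by rewrite -[leqLHS]muln1 leq_mul.
by rewrite expnMn leq_mul // leq_pexp2l // ltnW // ltn_expl.
Qed.

Section Ptime.
Variables (J : Type) (N : J -> nat).
Implicit Types (x y z : J -> data R).

Lemma ptime_of_runs_within k p x y :
  (forall j, runs_within k p (x j) (y j)) ->
  poly_bounded N (fun j => dsize (x j)) -> ptime N p x y.
Proof.
move=> run_p sx; exists (fun j => k * dsize (x j) ^ k)%N.
  by apply: poly_boundedM (poly_bounded_const _ _) (poly_boundedX _ sx).
by move=> j; have [t [ev_t t_le]] := run_p j; exists t.
Qed.

Lemma ptime_while_free p x y :
  while_free p -> (forall j, sem p (x j) = y j) -> ptime N p x y.
Proof.
move=> wf_p semp; exists (fun=> prog_size p); first exact: poly_bounded_const.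
by move=> j; rewrite -semp; apply: eval_while_free.
Qed.

Lemma ptime_comp p q x y z :
  ptime N p x y -> ptime N q y z -> ptime N (Comp q p) x z.
Proof.
move=> [f pf evp] [g pg evq]; exists (fun j => f j + g j + 1)%N.
  exact: poly_boundedD (poly_boundedD pf pg) (poly_bounded_const _ _).
move=> j; have [t t_le ev_t] := evp j; have [u u_le ev_u] := evq j.
by exists (t + u).+1; [rewrite addn1 ltnS leq_add | exact: eval_comp ev_t ev_u].
Qed.

Lemma ptime_fork p q x y z : ptime N p x y -> ptime N q x z ->
  ptime N (Fork p q) x (fun j => Pair (y j) (z j)).
Proof.
move=> [f pf evp] [g pg evq]; exists (fun j => f j + g j + 1)%N.
  exact: poly_boundedD (poly_boundedD pf pg) (poly_bounded_const _ _).
move=> j; have [t t_le ev_t] := evp j; have [u u_le ev_u] := evq j.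
by exists (t + u).+1; [rewrite addn1 ltnS leq_add | exact: eval_fork].
Qed.

(** Variable binding: the environment is a right-nested chain of pairs, and the new value becomes
    its entry 0. *)
Definition let_in p q := Comp q (Fork p (Prim Id)).

Lemma ptime_let p q x y z : ptime N p x y ->
  ptime N q (fun j => Pair (y j) (x j)) z -> ptime N (let_in p q) x z.
Proof.
move=> run_p; apply: ptime_comp; apply: ptime_fork run_p _.
exact: ptime_while_free.
Qed.

Lemma ptime_reindex (J' : Type) (N' : J' -> nat) (h : J' -> J) p x y :
  (forall j, N (h j) <= N' j)%N -> ptime N p x y ->
  ptime N' p (fun j => x (h j)) (fun j => y (h j)).
Proof.
move=> le_N [f pf evp]; exists (fun j => f (h j)); last by [].
exact: poly_bounded_reindex pf.
Qed.

(** A left fold. The remaining list itself serves as the loop condition, because an encoded list is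
    [Nil] exactly when it is empty. *)
Definition fold p :=
  Comp (Prim Snd)
    (While (Prim Fst)
       (Fork (Comp (Prim Snd) (Prim Fst))
             (Comp p (Fork (Comp (Prim Fst) (Prim Fst)) (Prim Snd))))).

End Ptime.

(** * Polynomial-time loops over lists *)

Section Fold.
Variables (J : Type) (N : J -> nat).

(* [st j i] is the accumulator after [i] of the elements of [s j]. *)
Lemma ptime_fold p (s : J -> seq (data R)) (st : J -> nat -> data R) :
  poly_bounded N (fun j => size (s j)) ->
  ptime (fun u : {j : J & 'I_(size (s j))} => N (tag u)) p
    (fun u => Pair (nth Defs.Nil (s (tag u)) (tagged u))
                   (st (tag u) (tagged u)))
    (fun u => st (tag u) (tagged u).+1) ->
  ptime N (fold p) (fun j => Pair (enc_seq (s j)) (st j 0%N))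
    (fun j => st j (size (s j))).
Proof.
move=> ps [f [k fk] evp].
(* Each iteration has an overhead of 12 steps around the body; the last, failing test takes 2 steps
   and the final projection 2 more. *)
exists (fun j => size (s j) * ((N j).+2 ^ k + 12) + 4)%N.
  apply: poly_boundedD (poly_bounded_const _ _).
  apply: poly_boundedM ps (poly_boundedD _ (poly_bounded_const _ _)).
  by exists k.
move=> j; set B := ((N j).+2 ^ k + 12)%N.
pose body := Fork (Comp (Prim Snd) (Prim Fst))
  (Comp p (Fork (Comp (Prim Fst) (Prim Fst)) (Prim Snd))).
suff loop i l : l = drop i (s j) -> (i <= size (s j))%N ->
    exists2 t, (t <= size l * B + 2)%N &
      eval (While (Prim Fst) body) (Pair (enc_seq l) (st j i)) t
        (Pair Defs.Nil (st j (size (s j)))).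
  have [t t_le ev_t] := loop 0%N (s j) (esym (drop0 _)) isT.
  exists (t + 1).+1; last exact: eval_comp ev_t (eval_prim _ _).
  by rewrite addn1 -addn2 (leq_trans (leq_add t_le (leqnn 2))) // -addnA.
elim: l i => [|a l IHl] i def_l i_le.
  have -> : i = size (s j).
    by apply/eqP; rewrite eqn_leq i_le -subn_eq0 -size_drop -def_l.
  by exists 2%N => //; apply: eval_while_stop; exact: (eval_prim Fst).
have i_lt : (i < size (s j))%N by rewrite -subn_gt0 -size_drop -def_l.
have [def_a def_l'] : nth Defs.Nil (s j) i = a /\ drop i.+1 (s j) = l.
  by move: def_l; rewrite (drop_nth Defs.Nil i_lt) => -[].
have [t t_le ev_t] := IHl i.+1 (esym def_l') i_lt.
have [u u_le] := evp (Tagged (fun j => 'I_(size (s j))) (Ordinal i_lt)).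
rewrite /= def_a => ev_u.
exists (1 + (3 + ((3 + 1).+1 + u).+1).+1 + t).+1; last first.
  apply: (@eval_while_step _ _ _ _ (Pair a (enc_seq l))
           (Pair (enc_seq l) (st j i.+1))) => //.
  - exact: (eval_prim Fst).
  - apply: eval_fork.
      exact: (eval_comp (eval_prim Fst _) (eval_prim Snd _)).
    apply: eval_comp ev_u; apply: eval_fork; last exact: (eval_prim Snd).
    exact: (eval_comp (eval_prim Fst _) (eval_prim Fst _)).
rewrite -[leqLHS]/(12 + u + t)%N /= mulSn -[leqRHS]addnA leq_add //.
rewrite /B addnC leq_add2r.
exact: leq_trans u_le (fk _).
Qed.

Lemma ptime_fold_while_free p (s : J -> seq (data R)) x :
  while_free p -> poly_bounded N (fun j => size (s j)) ->
  ptime N (fold p) (fun j => Pair (enc_seq (s j)) (x j))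
    (fun j => foldl (fun acc a => sem p (Pair a acc)) (x j) (s j)).
Proof.
move=> wf_p ps.
pose st j i := foldl (fun acc a => sem p (Pair a acc)) (x j) (take i (s j)).
have := @ptime_fold p s st ps.
have -> : (fun j => Pair (enc_seq (s j)) (st j 0%N)) =
          (fun j => Pair (enc_seq (s j)) (x j)).
  by apply: funext => j; rewrite /st take0.
have -> : (fun j => st j (size (s j))) =
    (fun j => foldl (fun acc a => sem p (Pair a acc)) (x j) (s j)).
  by apply: funext => j; rewrite /st take_size.
apply; apply: ptime_while_free => // u.
by rewrite /st (take_nth Defs.Nil (ltn_ord (tagged u))) -cats1 foldl_cat.
Qed.

End Fold.

End Programs.

(** * Approximation ratio *)

Section CoveringTheory.
Variables (R : realType) (C : covering_problem R).
Implicit Types (A F G S : {set ground C}) (X Y : {set 'I_(nreq C)}).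
Implicit Types (Omega : {set {set 'I_(nreq C)}}).

Lemma cost_ge0 F : 0 <= cost F.
Proof. by apply: sumr_ge0 => e _; apply: elt_cost_ge0. Qed.

Lemma cost0 : cost (set0 : {set ground C}) = 0.
Proof. by rewrite /cost big_set0. Qed.

Lemma cost_setD F G : F \subset G -> cost (G :\: F) = cost G - cost F.
Proof.
move=> sFG; rewrite [cost G](big_setID F) /= (setIidPr sFG).
by rewrite addrAC subrr add0r.
Qed.

Lemma le_cost F G : F \subset G -> cost F <= cost G.
Proof. by move=> sFG; rewrite -subr_ge0 -cost_setD // cost_ge0. Qed.

Lemma cost_setU F G : cost (F :|: G) <= cost F + cost G.
Proof.
rewrite -(subrK (cost F) (cost (F :|: G))) -cost_setD ?subsetUl //.
by rewrite addrC lerD2l le_cost // setDUl setDv set0U subsetDl.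
Qed.

Lemma satisfiesP F X :
  reflect (forall r, r \in X -> F \in req r) (satisfies F X).
Proof. exact: 'forall_in_idP. Qed.

Lemma robust_feasibleP Omega E0 (aug : {set 'I_(nreq C)} -> {set ground C}) :
  reflect (forall X, X \in Omega -> satisfies (E0 :|: aug X) X)
          (robust_feasible Omega E0 aug).
Proof. exact: 'forall_in_idP. Qed.

Lemma satisfies_sub F G X Y :
  F \subset G -> Y \subset X -> satisfies F X -> satisfies G Y.
Proof.
move=> sFG sYX /satisfiesP satF; apply/satisfiesP => r Yr.
by apply: req_upward sFG _; apply: satF; apply: (subsetP sYX).
Qed.

Lemma satisfiesU F X Y :
  satisfies F X -> satisfies F Y -> satisfies F (X :|: Y).
Proof.
move=> /satisfiesP FX /satisfiesP FY; apply/satisfiesP => r.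
by rewrite inE => /orP[/FX|/FY].
Qed.

Lemma opt_aug_le_cost X S A :
  satisfies (S :|: A) X -> opt_aug X S <= cost A.
Proof. exact: (@bigmin_le_cond _ _ _ _ _ (fun A => satisfies (S :|: A) X)). Qed.

Lemma opt_aug_ge0 X S : 0 <= opt_aug X S.
Proof. by apply/bigmin_geP; split=> *; apply: cost_ge0. Qed.

Lemma opt_aug_le_opt X S : opt_aug X S <= opt X.
Proof.
apply/bigmin_geP; split; first exact: bigmin_le_id.
move=> A; rewrite set0U => satA; apply: opt_aug_le_cost.
exact: satisfies_sub (subsetUr _ _) (subxx _) satA.
Qed.

Lemma opt_aug_le_maxmin Omega X S : X \in Omega ->
  opt_aug X S <= maxmin_aug Omega S.
Proof. by move=> XO; apply: (le_bigmax_cond _ (fun Y => opt_aug Y S)). Qed.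

(** A finite minimum is attained at one of its terms or at its default value; as [setT] satisfies
    every scenario, taking [setT] in both stages is feasible and costs at most the default. *)
Lemma robust_optimum Omega lambda : 0 <= lambda ->
    (forall X, X \in Omega -> satisfies setT X) ->
  exists E0 aug, robust_feasible Omega E0 aug /\
    robust_cost Omega lambda E0 aug <= robust_opt Omega lambda.
Proof.
move=> lambda0 satT; rewrite /robust_opt.
apply: (big_ind (fun v => exists E0 aug, robust_feasible Omega E0 aug /\
    robust_cost Omega lambda E0 aug <= v)).
- exists setT, (fun=> setT); split.
    by apply/robust_feasibleP => X XO; rewrite setUid satT.
  rewrite lerD2l ler_wpM2l //; apply/bigmax_leP; split=> //.
  exact: cost_ge0.
- move=> v w [E0 [aug [feas le_v]]] [E0' [aug' [feas' le_w]]].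
  case: (leP v w) => _; first by exists E0, aug.
  by exists E0', aug'.
- by move=> s feas; exists s.1, s.2.
Qed.

Lemma robust_opt_le Omega lambda E0 aug : robust_feasible Omega E0 aug ->
  robust_opt Omega lambda <= robust_cost Omega lambda E0 aug.
Proof.
move=> feas; set s := (E0, [ffun X => aug X]).
have -> : robust_cost Omega lambda E0 aug = robust_cost Omega lambda s.1 s.2.
  congr (_ + _ * _); apply: eq_bigr => X _.
  by rewrite ffunE.
apply: (@bigmin_le_cond _ _ _ _ s
  (fun s => robust_feasible Omega s.1 s.2)
  (fun s => robust_cost Omega lambda s.1 s.2)).
apply/robust_feasibleP => X XO; rewrite ffunE.
exact: (robust_feasibleP _ _ _ feas).
Qed.

End CoveringTheory.

(** * The online algorithm run against max-min scenarios *)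

Section OnlineRun.
Variables (R : realType) (C : covering_problem R).
Variables (on : seq 'I_(nreq C) -> {set ground C}).
Variables (mm : {set ground C} -> {set 'I_(nreq C)}).
Variable (lambda : R).

Fixpoint scenarios (t : nat) : seq 'I_(nreq C) :=
  if t is u.+1 then scenarios u ++ enum (mm (on (scenarios u))) else [::].

Definition online_sol (t : nat) : {set ground C} := on (scenarios t).

Definition score (t : nat) : R :=
  cost (online_sol t) + lambda * (cost (online_sol t.+1) - cost (online_sol t)).

(* The index among [0, ..., m - 1] of least score; junk for [m = 0]. *)
Fixpoint best (m : nat) : nat :=
  if m is t.+1 then
    if (0 < t)%N && (score (best t) <= score t) then best t else t
  else 0%N.

Lemma score_best m t : (t < m)%N -> score (best m) <= score t.
Proof.
elim: m t => // m IHm t; rewrite ltnS leq_eqVlt /=.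
case/predU1P=> [->|lt_tm]; first by case: ifP => // /andP[].
rewrite (leq_ltn_trans _ lt_tm) //=.
case: (leP (score (best m))) => [_|/ltW le_m]; first exact: IHm.
exact: le_trans le_m (IHm _ lt_tm).
Qed.

Hypothesis on_rcons : forall sigma r, on sigma \subset on (rcons sigma r).
Hypothesis on_satisfies : forall sigma, satisfies (on sigma) [set r in sigma].

Lemma on_cat sigma tau : on sigma \subset on (sigma ++ tau).
Proof.
elim/last_ind: tau => [|tau r IH]; first by rewrite cats0.
by rewrite -rcons_cat (subset_trans IH).
Qed.

Lemma online_solS t : online_sol t \subset online_sol t.+1.
Proof. exact: on_cat. Qed.

Lemma set_scenariosS t :
  [set r in scenarios t.+1] =
  [set r in scenarios t] :|: mm (online_sol t).
Proof. by apply/setP=> r; rewrite !inE mem_cat mem_enum. Qed.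

(** The elements bought in the next round form a valid augmentation for the scenario that triggered
    them. *)
Lemma opt_aug_mm_le t :
  opt_aug (mm (online_sol t)) (online_sol t) <=
    cost (online_sol t.+1) - cost (online_sol t).
Proof.
rewrite -cost_setD ?online_solS //; apply: opt_aug_le_cost.
rewrite setDE setUIr setUCr setIT (setUidPr (online_solS t)).
apply: satisfies_sub (subxx _) _ (on_satisfies (scenarios t.+1)).
by rewrite set_scenariosS subsetUr.
Qed.

(* The increasing sets [online_sol t] cannot all be distinct. *)
Lemma online_sol_stalls :
  exists2 t, (t <= #|ground C|)%N & online_sol t.+1 = online_sol t.
Proof.
have [[t stalls]|grows] := pselect (exists t : 'I_#|ground C|.+1,
    online_sol t.+1 = online_sol t).
  by exists t => //; rewrite -ltnS.
(* Without a stall the cardinalities increase strictly, and the set of index [#|ground C| + 1] is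
   too large. *)
suff /(_ _ (leqnn _)) : forall t, (t <= #|ground C|.+1)%N ->
    (t <= #|online_sol t|)%N.
  by rewrite leqNgt ltnS max_card.
elim=> // t IHt lt_t; apply: leq_ltn_trans (IHt (ltnW lt_t)) _.
apply: proper_card; rewrite properEneq online_solS andbT.
apply/eqP=> eq_t; apply: grows.
by exists (Ordinal lt_t).
Qed.

Variables (Omega : {set {set 'I_(nreq C)}}).
Variables (aug : {set 'I_(nreq C)} -> {set ground C}).
Variables (E0 : {set ground C}) (T alpha : R).
Hypothesis mmO : forall S, mm S \in Omega.
Hypothesis aug_feasible : robust_feasible Omega E0 aug.
Hypothesis cost_aug_le : forall X, X \in Omega -> cost (aug X) <= T.

(** [E0] together with the [aug] sets of the [t] scenarios found satisfies all their requirements.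
    The induction keeps [E0 \subset G], without which feasibility of [aug] could not be applied. *)
Lemma opt_scenarios_le t : opt [set r in scenarios t] <= cost E0 + t%:R * T.
Proof.
suff [G [sE0G satG le_G]] : exists G : {set ground C},
    [/\ E0 \subset G, satisfies G [set r in scenarios t]
      & cost G <= cost E0 + t%:R * T].
  by apply: le_trans le_G; apply: opt_aug_le_cost; rewrite set0U.
elim: t => [|t [G [sE0G satG le_G]]].
  exists E0; split=> //; last by rewrite mul0r addr0.
  by apply/satisfiesP => r; rewrite inE.
set A := aug (mm (online_sol t)).
exists (G :|: A); split.
- exact: subset_trans sE0G (subsetUl _ _).
- rewrite set_scenariosS; apply: satisfiesU.
    exact: satisfies_sub (subsetUl _ _) (subxx _) satG.
  apply: satisfies_sub (setSU _ sE0G) (subxx _) _.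
  exact: (robust_feasibleP _ _ _ aug_feasible).
- rewrite -natr1 mulrDl mul1r addrA; apply: le_trans (cost_setU _ _) _.
  by rewrite lerD // cost_aug_le.
Qed.

Hypothesis alpha_ge0 : 0 <= alpha.
Hypothesis T_ge0 : 0 <= T.
Hypothesis lambda_ge0 : 0 <= lambda.
Hypothesis on_competitive :
  forall sigma, cost (on sigma) <= alpha * opt [set r in sigma].

(* At the first step that costs at most [2 * alpha * T], all the previous steps
   have paid more than this, while competitiveness allows at most
   [alpha * T] per step beyond [alpha * cost E0]. *)
Lemma score_best_le :
  score (best #|ground C|.+1) <= 2 * alpha * (cost E0 + lambda * T).
Proof.
pose cheap t := cost (online_sol t.+1) - cost (online_sol t) <= 2 * alpha * T.
have cheapT : 0 <= 2 * alpha * T by rewrite !mulr_ge0.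
have [t0 t0_le stall] := online_sol_stalls.
have ex_cheap : exists t, cheap t by exists t0; rewrite /cheap stall subrr.
have cheap_t0 : cheap t0 by rewrite /cheap stall subrr.
(* The least cheap index is at most the stalling one, hence among those that [best] compares. *)
have [t cheap_t min_t] := ex_minnP ex_cheap.
have t_lt : (t < #|ground C|.+1)%N.
  by rewrite ltnS (leq_trans (min_t _ cheap_t0)).
apply: le_trans (score_best t_lt) _.
have grow : t%:R * (2 * alpha * T) <= cost (online_sol t).
  have : forall u, (u < t)%N -> ~~ cheap u.
    by move=> u lt_ut; apply: contraL lt_ut => /min_t; rewrite -leqNgt.
  elim: {cheap_t min_t t_lt}t => [|t IHt] exp; first by rewrite mul0r cost_ge0.
  have := exp t (leqnn _); rewrite /cheap -ltNge => exp_t.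
  have {}IHt := IHt (fun u lt_ut => exp u (ltnW lt_ut)).
  by rewrite -natr1; nra.
have comp : cost (online_sol t) <= alpha * (cost E0 + t%:R * T).
  apply: le_trans (on_competitive _) _.
  by rewrite ler_wpM2l // opt_scenarios_le.
(* By [grow], the term [alpha * t%:R * T] of [comp] is at most half of [cost (online_sol t)]; moving
   it to the left-hand side gives the factor 2. *)
have le_F : cost (online_sol t) <= 2 * alpha * cost E0 by nra.
rewrite mulrDr /score lerD //.
by rewrite mulrCA ler_wpM2l.
Qed.

End OnlineRun.

(** * Approximation ratio of the robust solution *)

Section Ratio.
Variables (R : realType) (C : covering_problem R).
Variables (on : seq 'I_(nreq C) -> {set ground C}).
Variables (mm : {set ground C} -> {set 'I_(nreq C)}).
Variables (off : {set ground C} -> {set 'I_(nreq C)} -> {set ground C}).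
Variables (Omega : {set {set 'I_(nreq C)}}) (lambda : R).
Variables (alpha_off alpha_on alpha_mm : R).
Hypothesis lambda_ge1 : 1 <= lambda.
Hypothesis alpha_mm_gt0 : 0 < alpha_mm.
Hypothesis off_satisfies : forall S X, satisfies (S :|: off S X) X.
Hypothesis off_approx :
  forall S X, cost (off S X) <= alpha_off * opt_aug X S.
Hypothesis on_satisfies : forall sigma, satisfies (on sigma) [set r in sigma].
Hypothesis on_rcons : forall sigma r, on sigma \subset on (rcons sigma r).
Hypothesis on_competitive :
  forall sigma, cost (on sigma) <= alpha_on * opt [set r in sigma].
Hypothesis mmO : forall S, mm S \in Omega.
Hypothesis mm_approx :
  forall S, alpha_mm^-1 * maxmin_aug Omega S <= opt_aug (mm S) S.

Let lambda_ge0 : 0 <= lambda.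
Proof. exact: le_trans ler01 lambda_ge1. Qed.

Lemma maxmin_aug_mm S : maxmin_aug Omega S <= alpha_mm * opt_aug (mm S) S.
Proof. by rewrite -ler_pdivrMl. Qed.

Lemma opt_aug_mm X S : X \in Omega ->
  opt_aug X S <= alpha_mm * opt_aug (mm S) S.
Proof.
by move=> XO; apply: le_trans (opt_aug_le_maxmin _ XO) (maxmin_aug_mm _).
Qed.

(* If a ratio is smaller than 1, the quantity that it bounds is 0 throughout. *)
Lemma degenerate_opt_aug :
  ~~ [&& 1 <= alpha_off, 1 <= alpha_on & 1 <= alpha_mm] ->
  forall S X, X \in Omega -> opt_aug X S = 0.
Proof.
have small (a v : R) : a < 1 -> v <= a * v -> v <= 0.
  by move=> a1 le_v; nra.
rewrite !negb_and -!ltNge => deg S X XO; apply/le_anti.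
rewrite opt_aug_ge0 andbT.
(* In each case an optimum is at most the ratio times itself: [opt_aug X S] through the output of
   [off], [opt X] by feeding [on] an enumeration of [X], and [maxmin_aug Omega S] through the
   scenario [mm S]. *)
case/or3P: deg => [lt1|lt1|lt1].
- apply: small lt1 _; apply: le_trans (off_approx _ _).
  exact: opt_aug_le_cost.
- apply: le_trans (opt_aug_le_opt _ _) _; apply: small lt1 _.
  have := on_competitive (enum X); rewrite set_enum; apply: le_trans.
  apply: opt_aug_le_cost; rewrite set0U.
  by have := on_satisfies (enum X); rewrite set_enum.
- apply: le_trans (opt_aug_le_maxmin _ XO) _; apply: small lt1 _.
  apply: le_trans (maxmin_aug_mm _) _.
  by rewrite ler_wpM2l ?opt_aug_le_maxmin // ltW.
Qed.

Definition first_stage := online_sol on mm (best on mm lambda #|ground C|.+1).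

Lemma robust_ratio :
  robust_feasible Omega first_stage (off first_stage) /\
  robust_cost Omega lambda first_stage (off first_stage) <=
    2 * (alpha_off * alpha_on * alpha_mm) * robust_opt Omega lambda.
Proof.
split; first by apply/robust_feasibleP => X _; apply: off_satisfies.
have satT X : X \in Omega -> satisfies [set: ground C] X.
  move=> _; apply: satisfies_sub (subsetT _) (subxx _) (off_satisfies set0 X).
have [E0 [aug [feas le_opt]]] := robust_optimum lambda_ge0 satT.
set T := \big[Num.max/0]_(w in Omega) cost (aug w) in le_opt.
have le_T X : X \in Omega -> cost (aug X) <= T.
  by move=> XO; apply: (le_bigmax_cond _ (fun Y => cost (aug Y))).
have T_ge0 : 0 <= T by apply: bigmax_ge_id.
have E0_ge0 : 0 <= cost E0 := cost_ge0 _.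
rewrite /first_stage; set t := best _ _ _ _; set F := online_sol _ _ t.
pose inc := cost (online_sol on mm t.+1) - cost F.
have mm_inc : opt_aug (mm F) F <= inc by apply: opt_aug_mm_le.
have [/and3P[off1 on1 mm1]|/degenerate_opt_aug opt0] :=
  boolP [&& 1 <= alpha_off, 1 <= alpha_on & 1 <= alpha_mm].
  have [off_ge0 on_ge0] : 0 <= alpha_off /\ 0 <= alpha_on by lra.
  have mm_ge0 : 0 <= alpha_mm := ltW alpha_mm_gt0.
  have scoreF : cost F + lambda * inc <= 2 * alpha_on * (cost E0 + lambda * T).
    exact: score_best_le feas le_T _ _ _ _.
  have inc_ge0 : 0 <= inc by apply: le_trans mm_inc; apply: opt_aug_ge0.
  have off_le : \big[Num.max/0]_(w in Omega) cost (off F w) <=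
      alpha_off * alpha_mm * inc.
    apply/bigmax_leP; split; first by rewrite !mulr_ge0.
    move=> X XO; apply: le_trans (off_approx _ _) _.
    rewrite -mulrA ler_wpM2l //.
    by rewrite (le_trans (opt_aug_mm _ XO)) // ler_wpM2l.
  (* Only the second stage pays the factor [alpha_off * alpha_mm]; being at least 1, it can be put
     on the first-stage cost too, so that the score factors out. *)
  have am1 : 1 <= alpha_off * alpha_mm by rewrite mulr_ege1.
  apply: le_trans (_ : alpha_off * alpha_mm * (cost F + lambda * inc) <= _).
    rewrite mulrDr mulrCA lerD ?ler_peMl ?cost_ge0 //.
    by rewrite ler_wpM2l.
  apply: le_trans (_ : alpha_off * alpha_mm *
    (2 * alpha_on * robust_opt Omega lambda) <= _).
    rewrite ler_wpM2l ?mulr_ge0 //; apply: le_trans scoreF _.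
    by rewrite ler_wpM2l // mulr_ge0.
  by rewrite le_eqVlt; apply/orP; left; apply/eqP; ring.
(* Degenerate case: [set0] completed by [off set0] is a robust solution of cost 0, so the computed
   solution must cost 0 as well. *)
have off0 S X : X \in Omega -> cost (off S X) = 0.
  move=> XO; apply/le_anti; rewrite cost_ge0 andbT.
  by rewrite (le_trans (off_approx _ _)) // opt0 // mulr0.
have max0 S : \big[Num.max/0]_(w in Omega) cost (off S w) = 0.
  apply/le_anti; rewrite bigmax_ge_id andbT.
  by apply/bigmax_leP; split=> // X XO; rewrite off0.
have feas0 : robust_feasible Omega set0 (off set0).
  by apply/robust_feasibleP => X _; apply: off_satisfies.
have opt_scen u : opt [set r in scenarios on mm u] <= 0.
  have := @opt_scenarios_le _ _ on mm Omega (off set0) set0 0 mmO feas0 _ u.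
  rewrite cost0 mulr0 addr0; apply=> X XO.
  by rewrite off0.
have cost_F : cost F <= 0.
  apply: le_trans (on_competitive _) _.
  (* The sign of [alpha_on] is unknown here, so the optimum has to be exactly 0. *)
  suff -> : opt [set r in scenarios on mm t] = 0 by rewrite mulr0.
  by apply/le_anti; rewrite opt_scen opt_aug_ge0.
have opt_le0 := robust_opt_le lambda feas0.
rewrite /robust_cost max0 cost0 mulr0 addr0 in opt_le0.
suff -> : robust_opt Omega lambda = 0.
  by rewrite /robust_cost max0 !mulr0 addr0.
apply/le_anti; rewrite opt_le0 (le_trans _ le_opt) //.
by rewrite addr_ge0 // mulr_ge0.
Qed.

End Ratio.

(** * The robust program *)

Section EncodingSizes.
Variable R : realType.
Local Open Scope nat_scope.
Implicit Types (s : seq (data R)).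

Lemma size_le_dsize s : size s <= dsize (enc_seq s).
Proof. by elim: s => //= a s IH; rewrite ltnS (leq_trans IH) ?leq_addl. Qed.

Lemma dsize_enc_seq_map_le (T : Type) (f : T -> data R) (s : seq T) b :
  (forall x, dsize (f x) <= b) ->
  dsize (enc_seq [seq f x | x <- s]) <= size s * b.+1 + 1.
Proof.
move=> le_b; elim: s => //= x s IH.
by rewrite mulSn -addnA addSn ltnS leq_add.
Qed.

Lemma dsize_enc_nat n : dsize (enc_nat n : data R) = n.*2.+1.
Proof. by elim: n => //= n ->; rewrite doubleS. Qed.

Lemma dsize_enc_set_le (T : finType) (A : {set T}) :
  dsize (enc_set A : data R) <= #|T| * 4 + 1.
Proof.
rewrite cardE; apply: (@dsize_enc_seq_map_le _ _ _ 3) => x.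
by case: (x \in A).
Qed.

Lemma dsize_enc_ords_le n (s : seq 'I_n) :
  dsize (enc_ords s : data R) <= size s * (n.*2.+2) + 1.
Proof.
apply: dsize_enc_seq_map_le => i; rewrite dsize_enc_nat ltnS leq_double.
exact: ltnW.
Qed.

End EncodingSizes.

Local Notation "p >>> q" := (Comp q p) (at level 40, left associativity).

Fixpoint field (n : nat) : prog :=
  if n is m.+1 then Prim Snd >>> field m else Prim Fst.

(* Reads an element's cost [c] against the accumulator [((b :: bs), v)]. *)
Definition add_cost : prog :=
  Fork (Prim Snd >>> Prim Fst >>> Prim Snd)
    (If (Prim Snd >>> Prim Fst >>> Prim Fst)
      (Fork (Prim Snd >>> Prim Snd) (Prim Fst) >>> Prim Add)
      (Prim Snd >>> Prim Snd)).

Definition cost_prog : prog := fold add_cost >>> Prim Snd.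

(* Reads a bit of a characteristic vector against the accumulator
   [(i, l)], where [i] is the index of this bit. *)
Definition push_index : prog :=
  Fork (Fork (Prim MkNil) (Prim Snd >>> Prim Fst))
    (If (Prim Fst) (Fork (Prim Snd >>> Prim Fst) (Prim Snd >>> Prim Snd))
       (Prim Snd >>> Prim Snd)).

Definition push_prog : prog := fold push_index >>> Prim Snd.

(** * Correctness and running time of the list-processing programs *)

Section ListPrograms.
Variable R : realType.

Lemma foldl_add_cost (T : Type) (c : T -> R) (P : pred T) (s : seq T) v :
  foldl (fun acc a => sem add_cost (Pair a acc))
    (Pair (enc_seq [seq enc_bool (P x) | x <- s]) (Defs.Real v))
    [seq Defs.Real (c x) | x <- s] =
  Pair Defs.Nil (Defs.Real (v + \sum_(x <- s | P x) c x)).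
Proof.
elim: s v => [|x s IH] v /=; first by rewrite big_nil addr0.
by rewrite big_cons; case: (P x); rewrite /= IH // addrA.
Qed.

(** As [s] runs through consecutive indices from [m], the unary counter always coincides with the
    encoding of the current element and can be pushed as it stands. *)
Lemma foldl_push_index n (P : pred 'I_n) (s l : seq 'I_n) m :
  [seq val i | i <- s] = iota m (size s) ->
  foldl (fun acc a => sem push_index (Pair a acc))
    (Pair (enc_nat m) (enc_ords l)) [seq enc_bool (P i) | i <- s] =
  Pair (enc_nat (m + size s)) (enc_ords (rev (filter P s) ++ l))
  :> data R.
Proof.
elim: s m l => [|i s IH] m l /=; first by rewrite addn0.
case=> def_i def_s; rewrite addnS -addSn; case: (P i) => /=.
  have -> : Pair (enc_nat m) (enc_ords l) = enc_ords (i :: l) :> data R.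
    by rewrite -def_i.
  by rewrite rev_cons cat_rcons; apply: (IH m.+1 (i :: l)).
exact: (IH m.+1 l).
Qed.

(** The body of a fold receives the head paired with the accumulator, which is already a cons cell:
    folding the identity reverses a list. *)
Lemma foldl_pair (s : seq (data R)) (l : seq (data R)) :
  foldl (fun acc a => sem (Prim Id) (Pair a acc)) (enc_seq l) s =
  enc_seq (catrev s l).
Proof. by elim: s l => //= a s IH l; apply: (IH (a :: l)). Qed.

Variables (J : Type) (N : J -> nat).

Lemma ptime_ext p (x x' y y' : J -> data R) :
  (forall j, x j = x' j) -> (forall j, y j = y' j) ->
  ptime N p x y -> ptime N p x' y'.
Proof. by move=> /funext <- /funext <-. Qed.

Lemma ptime_cost (C : J -> covering_problem R)
    (F : forall j, {set ground (C j)}) :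
  poly_bounded N (fun j => #|ground (C j)|) ->
  ptime N cost_prog
    (fun j => Pair
       (enc_seq [seq Defs.Real (elt_cost e) | e <- enum (ground (C j))])
       (Pair (enc_set (F j)) (Defs.Real 0)))
    (fun j => Defs.Real (cost (F j))).
Proof.
move=> pC; apply: ptime_comp.
  apply: ptime_fold_while_free => //.
  by apply: poly_bounded_le pC => j; rewrite size_map cardE.
apply: ptime_while_free => // j /=.
by rewrite foldl_add_cost add0r big_enum_cond.
Qed.

(** Pushing reverses the scenario. Hence [round] stores the requirement sequence reversed and
    reverses it back before calling the online program. *)
Lemma ptime_push (n : J -> nat) (X : forall j, {set 'I_(n j)})
    (l : forall j, seq 'I_(n j)) :
  poly_bounded N n ->
  ptime N push_prog
    (fun j => Pair (enc_set (X j)) (Pair Defs.Nil (enc_ords (l j))))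
    (fun j => enc_ords (rev (enum (X j)) ++ l j) : data R).
Proof.
move=> pn; apply: ptime_comp.
  apply: ptime_fold_while_free => //.
  by apply: poly_bounded_le pn => j; rewrite size_map size_enum_ord.
apply: ptime_while_free => // j.
rewrite (@foldl_push_index _ (mem (X j)) _ (l j) 0) /=.
  by rewrite {2}/enum_mem -enumT.
by rewrite val_enum_ord size_enum_ord.
Qed.

Lemma ptime_rev (n : J -> nat) (l : forall j, seq 'I_(n j)) :
  poly_bounded N (fun j => size (l j)) ->
  ptime N (fold (Prim Id))
    (fun j => Pair (enc_ords (l j)) Defs.Nil)
    (fun j => enc_ords (rev (l j)) : data R).
Proof.
move=> pl.
have ps :
  poly_bounded N (fun j => size [seq enc_nat i : data R | i : 'I_(n j) <- l j]).
  by apply: poly_bounded_le pl => j; rewrite size_map.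
apply: ptime_ext (ptime_fold_while_free (p := Prim Id) (fun=> Defs.Nil) isT ps).
  by [].
by move=> j; rewrite (foldl_pair _ [::]) -/(rev _) -map_rev.
Qed.

End ListPrograms.

Section RobustProgram.
Variables p_on p_mm p_off : prog.

(* Variables, in de Bruijn order at the end of the chain of [let_in]s: the
   score, [c(F')], [c(F)], [F'], the requirements so far, the same reversed, the
   new scenario, a counter cell, the instance, the reversed requirements before
   the new scenario, [F], the least score so far and the set reaching it. *)
Definition round : prog :=
  let_in (Fork (field 1 >>> Prim Fst)
            (Fork (field 1 >>> Prim Snd >>> Prim Fst) (field 3)) >>> p_mm)
 (let_in (Fork (field 0) (Fork (Prim MkNil) (field 3)) >>> push_prog)
 (let_in (Fork (field 0) (Prim MkNil) >>> fold (Prim Id))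
 (let_in (Fork (field 4 >>> Prim Fst) (field 0) >>> p_on)
 (let_in (Fork (field 5 >>> Prim Fst >>> Prim Fst)
            (Fork (field 7) (Prim Zero)) >>> cost_prog)
 (let_in (Fork (field 6 >>> Prim Fst >>> Prim Fst)
            (Fork (field 1) (Prim Zero)) >>> cost_prog)
 (let_in (Fork (field 1)
            (Fork (field 7 >>> Prim Snd >>> Prim Snd)
               (Fork (field 0) (field 1) >>> Prim Defs.Sub) >>> Prim Mul)
            >>> Prim Add)
  (Fork (field 8) (Fork (field 5) (Fork (field 3)
     (* [Leq] is false as long as the least score is the initial [Nil] *)
     (If (Fork (field 11) (field 0) >>> Prim Leq)
        (Fork (field 11) (Fork (field 12) (Prim MkNil)))
        (Fork (field 0) (Fork (field 10) (Prim MkNil))))))))))))).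

(** The list of costs with one extra cell in front has length |E| + 1 and serves as the loop
    counter. Both [Nil] fields after the first online solution mean that no set has been scored
    yet. *)
Definition first_stage_prog : prog :=
  let_in (Fork (Prim Fst) (Prim MkNil) >>> p_on)
    (Fork (Fork (Prim MkNil) (field 1 >>> Prim Fst))
       (Fork (Prim Snd) (Fork (Prim MkNil) (Fork (Prim Fst)
          (Fork (Prim MkNil) (Fork (Prim MkNil) (Prim MkNil)))))))
  >>> fold round >>> field 4.

(** The augmentation procedure is given only the instance and the scenario, so it recomputes the
    first-stage set. *)
Definition second_stage_prog : prog :=
  let_in (Prim Fst >>> first_stage_prog)
    (Fork (field 1 >>> Prim Fst) (Fork (Prim Fst) (Prim Snd >>> Prim Snd))
     >>> p_off).

End RobustProgram.

(** * Running time of the robust algorithm *)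

Section RobustAlgorithm.
Variables (R : realType) (I : Type) (C : I -> covering_problem R).
Variables (dC dO : I -> data R) (lambda : I -> R).
Variable on : forall i, seq 'I_(nreq (C i)) -> {set ground (C i)}.
Variable mm : forall i, {set ground (C i)} -> {set 'I_(nreq (C i))}.
Variables (p_on p_mm : prog) (k_on k_mm : nat).
Hypothesis run_on : forall i sigma, runs_within k_on p_on
  (Pair (enc_covering (C i) (dC i)) (enc_ords sigma)) (enc_set (@on i sigma)).
Hypothesis run_mm : forall i S, runs_within k_mm p_mm
  (Pair (enc_covering (C i) (dC i)) (Pair (dO i) (enc_set S)))
  (enc_set (@mm i S)).

Let x i : data R := enc_robust C dC dO lambda i.

Lemma dsize_enc_robust_ge i :
  [/\ #|ground (C i)| <= dsize (x i), nreq (C i) <= dsize (x i),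
      dsize (enc_covering (C i) (dC i)) <= dsize (x i)
    & dsize (dO i) <= dsize (x i)]%N.
Proof.
have leE : (#|ground (C i)| <=
    dsize (enc_seq [seq Defs.Real (elt_cost e) | e <- enum (ground (C i))]))%N.
  by rewrite cardE -(size_map (fun e => Defs.Real (elt_cost e))) size_le_dsize.
rewrite /x /enc_robust /enc_covering /= dsize_enc_nat.
by move: leE; set a := dsize _; set b := dsize _; set c := #|_|; split; lia.
Qed.

Section Bounds.
Variables (J : Type) (N : J -> nat) (h : J -> I).
Hypothesis N_ge : forall j, (dsize (x (h j)) <= N j)%N.

Let bounded (f : J -> nat) : (forall j, f j <= dsize (x (h j)))%N ->
  poly_bounded N f.
Proof.
move=> le_f; apply: poly_bounded_le (poly_bounded_size N) => j.
exact: leq_trans (le_f j) (N_ge j).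
Qed.

Lemma poly_bounded_ground : poly_bounded N (fun j => #|ground (C (h j))|).
Proof. by apply: bounded => j; case: (dsize_enc_robust_ge (h j)). Qed.

Lemma poly_bounded_nreq : poly_bounded N (fun j => nreq (C (h j))).
Proof. by apply: bounded => j; case: (dsize_enc_robust_ge (h j)). Qed.

Lemma poly_bounded_enc_covering :
  poly_bounded N (fun j => dsize (enc_covering (C (h j)) (dC (h j)))).
Proof. by apply: bounded => j; case: (dsize_enc_robust_ge (h j)). Qed.

Lemma poly_bounded_enc_set (F : forall j, {set ground (C (h j))}) :
  poly_bounded N (fun j => dsize (enc_set (F j) : data R)).
Proof.
apply: poly_bounded_le (fun j => dsize_enc_set_le R (F j)) _.
apply: poly_boundedD (poly_bounded_const _ _).
by apply: poly_boundedM (poly_bounded_const _ _); apply: poly_bounded_ground.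
Qed.

Lemma poly_bounded_enc_reqs (X : forall j, {set 'I_(nreq (C (h j)))}) :
  poly_bounded N (fun j => dsize (enc_set (X j) : data R)).
Proof.
apply: poly_bounded_le (fun j => dsize_enc_set_le R (X j)) _.
apply: poly_boundedD (poly_bounded_const _ _).
apply: poly_boundedM (poly_bounded_const _ _).
by apply: poly_bounded_le poly_bounded_nreq => j; rewrite card_ord.
Qed.

Lemma ptime_online (sigma : forall j, seq 'I_(nreq (C (h j)))) :
  poly_bounded N (fun j => size (sigma j)) ->
  ptime N p_on
    (fun j => Pair (enc_covering (C (h j)) (dC (h j))) (enc_ords (sigma j)))
    (fun j => enc_set (on (sigma j))).
Proof.
move=> p_sigma; apply: ptime_of_runs_within => [j|]; first exact: run_on.
apply: poly_bounded_le (_ : forall j, _ <=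
    dsize (enc_covering (C (h j)) (dC (h j))) +
    (size (sigma j) * (2 * nreq (C (h j)) + 2) + 1) + 1)%N _ => [j|].
  rewrite /= addn1 ltnS leq_add2l.
  by apply: leq_trans (dsize_enc_ords_le _ _) _; rewrite mul2n addn2.
apply: poly_boundedD (poly_bounded_const _ _).
apply: poly_boundedD poly_bounded_enc_covering _.
apply: poly_boundedD (poly_bounded_const _ _); apply: poly_boundedM p_sigma _.
apply: poly_boundedD (poly_bounded_const _ _).
exact: poly_boundedM (poly_bounded_const _ _) poly_bounded_nreq.
Qed.

Lemma ptime_maxmin (S : forall j, {set ground (C (h j))}) :
  ptime N p_mm
    (fun j => Pair (enc_covering (C (h j)) (dC (h j)))
       (Pair (dO (h j)) (enc_set (S j))))
    (fun j => enc_set (mm (S j))).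
Proof.
apply: ptime_of_runs_within => [j|]; first exact: run_mm.
apply: poly_bounded_le (_ : forall j, _ <=
    dsize (enc_covering (C (h j)) (dC (h j))) +
    (dsize (dO (h j)) + dsize (enc_set (S j) : data R) + 1) + 1)%N _ => [j|].
  by rewrite /= !addn1.
apply: poly_boundedD (poly_bounded_const _ _).
apply: poly_boundedD poly_bounded_enc_covering _.
apply: poly_boundedD (poly_bounded_const _ _).
apply: poly_boundedD (poly_bounded_enc_set _).
by apply: bounded => j; case: (dsize_enc_robust_ge (h j)).
Qed.

End Bounds.

(** Keeps the input of the online program polynomial over all the rounds. *)
Lemma size_scenarios_le i t :
  (size (scenarios (@on i) (@mm i) t) <= t * nreq (C i))%N.
Proof.
elim: t => //= t IH; rewrite size_cat mulSn addnC leq_add // -cardE.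
by rewrite -[leqRHS]card_ord max_card.
Qed.

Let Fsol i t := online_sol (@on i) (@mm i) t.
Let reqs i t := scenarios (@on i) (@mm i) t.
Let best_score i t : data R := if t is u.+1 then
  Defs.Real (score (@on i) (@mm i) (lambda i)
               (best (@on i) (@mm i) (lambda i) t))
  else Defs.Nil.
Let best_sol i t : data R := if t is u.+1 then
  enc_set (Fsol i (best (@on i) (@mm i) (lambda i) t)) else Defs.Nil.
Let state i t : data R := enc_seq
  [:: x i; enc_ords (rev (reqs i t)); enc_set (Fsol i t); best_score i t;
      best_sol i t].

(** Follows the [let_in]s of [round] in order; only the calls to [p_mm] and [p_on] and the four
    folds are not loop-free. *)
Lemma ptime_round (J : Type) (N : J -> nat) (h : J -> I) (t : J -> nat)
    (e : J -> data R) :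
  (forall j, dsize (x (h j)) <= N j)%N -> poly_bounded N t ->
  ptime N (round p_on p_mm) (fun j => Pair (e j) (state (h j) (t j)))
    (fun j => state (h j) (t j).+1).
Proof.
move=> N_ge pt.
have preqs : poly_bounded N (fun j => size (reqs (h j) (t j).+1)).
  apply: poly_bounded_le (fun j => size_scenarios_le (h j) (t j).+1) _.
  apply: poly_boundedM (poly_bounded_nreq N_ge).
  apply: poly_bounded_le (poly_boundedD pt (poly_bounded_const N 1)) => j.
  by rewrite addn1.
have pE := poly_bounded_ground N_ge.
apply: ptime_let.
  apply: ptime_comp (ptime_maxmin N_ge (fun j => Fsol (h j) (t j))).
  exact: ptime_while_free.
apply: (ptime_let (y := fun j => enc_ords (rev (reqs (h j) (t j).+1)))).
  apply: ptime_comp (ptime_ext _ _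
    (ptime_push R (fun j => mm (Fsol (h j) (t j)))
       (fun j => rev (reqs (h j) (t j))) (poly_bounded_nreq N_ge))).
  - exact: ptime_while_free.
  - by [].
  - by move=> j; rewrite -rev_cat.
apply: (ptime_let (y := fun j => enc_ords (reqs (h j) (t j).+1))).
  apply: ptime_comp (ptime_ext _ _ (ptime_rev R
    (l := fun j => rev (reqs (h j) (t j).+1)) _)).
  - exact: ptime_while_free.
  - by [].
  - by move=> j; rewrite revK.
  - by apply: poly_bounded_le preqs => j; rewrite size_rev.
apply: ptime_let.
  by apply: ptime_comp (ptime_online N_ge preqs); apply: ptime_while_free.
apply: ptime_let.
  apply: ptime_comp (ptime_cost (fun j => Fsol (h j) (t j)) pE).
  exact: ptime_while_free.
apply: ptime_let.
  apply: ptime_comp (ptime_cost (fun j => Fsol (h j) (t j).+1) pE).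
  exact: ptime_while_free.
apply: ptime_let.
  apply: (@ptime_while_free _ _ _ _ _
    (fun j => Defs.Real
       (score (@on (h j)) (@mm (h j)) (lambda (h j)) (t j)))) => //.
apply: ptime_while_free => // j.
(* At round 0 the comparison with [Nil] fails and the current set is recorded; later it is the test
   made by [best]. *)
rewrite /state /best_score /best_sol; case: (t j) => [|u] //=.
by case: (_ <= score _ _ _ u.+1).
Qed.

Lemma ptime_first_stage :
  ptime (fun i => dsize (x i)) (first_stage_prog p_on p_mm) x
    (fun i => enc_set (first_stage (@on i) (@mm i) (lambda i))).
Proof.
pose N i := dsize (x i); have N_ge i : (dsize (x i) <= N i)%N by [].
pose s i : seq (data R) :=
  Defs.Nil :: [seq Defs.Real (elt_cost e) | e <- enum (ground (C i))].
have size_s i : size (s i) = #|ground (C i)|.+1 by rewrite /= size_map cardE.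
have ps : poly_bounded N (fun i => size (s i)).
  apply: poly_bounded_le (_ : forall i, _ <= #|ground (C i)| + 1)%N _ => [i|].
    by rewrite size_s addn1.
  exact: poly_boundedD (poly_bounded_ground N_ge) (poly_bounded_const _ _).
apply: (@ptime_comp _ _ _ _ _ _ (fun i => state i (size (s i)))); last first.
  by apply: ptime_while_free => // i; rewrite size_s.
apply: ptime_comp (ptime_fold (st := state) ps _).
  apply: ptime_let.
    apply: ptime_comp (ptime_online (sigma := fun i => [::]) N_ge
      (poly_bounded_const _ 0)).
    exact: ptime_while_free.
  exact: ptime_while_free.
apply: ptime_round => //.
apply: poly_bounded_le (poly_bounded_reindex (h := tag) _ ps) => // u.
exact: ltnW.
Qed.

(** Indexing by pairs of an instance and a scenario makes one time bound cover all scenarios; the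
    first-stage bound is transferred along [tag]. *)
Lemma ptime_second_stage (p_off : prog) (k_off : nat)
    (off : forall i, {set ground (C i)} -> {set 'I_(nreq (C i))} ->
       {set ground (C i)}) :
  (forall i S X, runs_within k_off p_off
     (Pair (enc_covering (C i) (dC i)) (Pair (enc_set S) (enc_set X)))
     (enc_set (@off i S X))) ->
  ptime (fun u : {i & {set 'I_(nreq (C i))}} =>
           dsize (Pair (x (tag u)) (enc_set (tagged u))))
    (second_stage_prog p_on p_mm p_off)
    (fun u => Pair (x (tag u)) (enc_set (tagged u)))
    (fun u => enc_set (off (tag u)
       (first_stage (@on (tag u)) (@mm (tag u)) (lambda (tag u))) (tagged u))).
Proof.
move=> run_off.
set N := fun u => dsize _.
have N_ge u : (dsize (x (tag u)) <= N u)%N by apply: leqW (leq_addr _ _).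
apply: ptime_let.
  apply: ptime_comp (ptime_reindex (h := tag) N_ge ptime_first_stage).
  exact: ptime_while_free.
pose E0 (u : {i & {set 'I_(nreq (C i))}}) :=
  first_stage (@on (tag u)) (@mm (tag u)) (lambda (tag u)).
apply: (ptime_comp (y := fun u => Pair (enc_covering (C (tag u)) (dC (tag u)))
  (Pair (enc_set (E0 u)) (enc_set (tagged u))))).
  exact: ptime_while_free.
apply: ptime_of_runs_within => [u|]; first exact: run_off.
apply: poly_bounded_le (_ : forall u, _ <=
    dsize (enc_covering (C (tag u)) (dC (tag u))) +
    (dsize (enc_set (E0 u) : data R) +
     dsize (enc_set (tagged u) : data R) + 1) + 1)%N _ => [u|].
  by rewrite /= !addn1.
apply: poly_boundedD (poly_bounded_const _ _).
apply: poly_boundedD (poly_bounded_enc_covering N_ge) _.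
apply: poly_boundedD (poly_bounded_const _ _).
apply: poly_boundedD (poly_bounded_enc_set N_ge E0) _.
exact: poly_bounded_enc_reqs N_ge (fun u => tagged u).
Qed.

End RobustAlgorithm.

Theorem theorem4p1 (R : realType) :
  exists K : R, 0 < K /\
  forall (I : Type) (C : I -> covering_problem R)
         (Omega : forall i, {set {set 'I_(nreq (C i))}}) (lambda : I -> R)
         (dC dO : I -> data R)
         (alpha_off alpha_on alpha_mm : I -> R),
    (forall i, 1 <= lambda i) ->
    (forall i, 0 < alpha_mm i) ->
    augmentation_algorithm C dC alpha_off ->
    online_algorithm C dC alpha_on ->
    maxmin_algorithm C dC dO Omega alpha_mm ->
    robust_algorithm C dC dO Omega lambda
      (fun i => K * (alpha_off i * alpha_on i * alpha_mm i)).
Proof.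
exists 2; split=> // I C Omega lambda dC dO alpha_off alpha_on alpha_mm.
move=> lambda_ge1 mm_gt0 [p_off [k_off [off offP]]] [p_on [k_on [on onP]]].
move=> [p_mm [k_mm [mm mmP]]].
have run_off i S X := let: And3 r _ _ := offP i S X in r.
have run_on i sigma := let: And4 r _ _ _ := onP i sigma in r.
have run_mm i S := let: And3 r _ _ := mmP i S in r.
have [k1 run1] :=
  ptime_runs_within (ptime_first_stage lambda run_on run_mm).
have [k2 run2] :=
  ptime_runs_within (ptime_second_stage lambda run_on run_mm run_off).
pose E0 i := first_stage (@on i) (@mm i) (lambda i).
exists (first_stage_prog p_on p_mm), (second_stage_prog p_on p_mm p_off).
(* A common exponent for both programs, by monotonicity of [runs_within] in [k]. *)
exists (k1 + k2)%N, E0, (fun i => off i (E0 i)) => i.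
have [feas ratio] : robust_feasible (Omega i) (E0 i) (off i (E0 i)) /\
    robust_cost (Omega i) (lambda i) (E0 i) (off i (E0 i)) <=
      2 * (alpha_off i * alpha_on i * alpha_mm i) *
        robust_opt (Omega i) (lambda i).
  apply: robust_ratio => // [S X|S X|sigma|sigma r|sigma|S|S].
  - by case: (offP i S X).
  - by case: (offP i S X).
  - by case: (onP i sigma).
  - by case: (onP i sigma).
  - by case: (onP i sigma).
  - by case: (mmP i S).
  - by case: (mmP i S).
split=> // [|X _].
  exact: runs_within_leq (leq_addr _ _) (run1 i).
apply: runs_within_leq (leq_addl _ _) _.
exact: (run2 (Tagged (fun i => {set 'I_(nreq (C i))}) X)).
Qed.
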